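(* Let $NC(6n+3,3)$ be the number of non-isomorphic cyclic Steiner triple systems of order $6n+3$. Then there is an integer $N$ such that for all $n\ge N$: - if $n\equiv 3,5,24,26 \pmod{28}$, then $NC(6n+3,3)\ge (3.35)^n$; - if $n\not\equiv 3,5,24,26 \pmod{28}$, then $NC(6n+3,3)\ge (2.49)^n$.
   Context: A Steiner triple system of order $v$, $STS(v)$, is a $3$-cycle system of the complete graph $K_v$: a set $\mathcal{B}$ of $3$-cycles (triangles) of $K_v$ whose edges partition the edge-set of $K_v$. It is cyclic if the vertex-set can be identified with $\mathbb{Z}_v$ in such a way that $B\in\mathcal{B}$ implies $B+z\in\mathcal{B}$ for all $z\in\mathbb{Z}_v$, where $(b_1,b_2,b_3)+z=(b_1+z,b_2+z,b_3+z)$. Two such systems with cycle sets $\mathcal{B}$ and $\mathcal{B}'$ are isomorphic if there is a permutation of the vertex-set turning $\mathcal{B}$ into $\mathcal{B}'$. $NC(v,3)$ is the number of cyclic $STS(v)$s up to isomorphism. *)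

(* Defs.v *)
From mathcomp Require Import all_boot all_order all_fingroup all_algebra.

Set Implicit Arguments.
Unset Strict Implicit.
Unset Printing Implicit Defensive.

(** Edges of the complete graph with vertex-set [A]. *)
Definition edges (V : finType) (A : {set V}) : {set {set V}} :=
  [set e in powerset A | #|e| == 2].

(** A 3-cycle of a complete graph is determined by its vertices, so it is
    encoded as a 3-subset [b], whose edges are [edges b].  Since [edges] is
    injective on 3-subsets, passing to the set [edges @: B] does not merge two
    distinct cycles. *)
Definition is_STS (V : finType) (B : {set {set V}}) : bool :=
  [forall b in B, #|b| == 3] && partition (@edges V @: B) (edges [set: V]).

Definition relabel (V : finType) (f : {perm V}) (B : {set {set V}}) :
  {set {set V}} := [set [set f x | x in b] | b : {set V} in B].

Definition iso (V : finType) : rel {set {set V}} :=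
  fun B B' => [exists f : {perm V}, relabel f B == B'].

Definition shift (v : nat) (z : 'Z_v) (b : {set 'Z_v}) : {set 'Z_v} :=
  [set (x + z)%R | x in b].

(** [f] is the identification of the vertex-set with the group Z_v. *)
Definition is_cyclic (v : nat) (B : {set {set 'Z_v}}) : bool :=
  [exists f : {perm 'Z_v},
    [forall b in relabel f B, forall z : 'Z_v, shift z b \in relabel f B]].

(** Number of isomorphism classes of cyclic STS(v); meaningful for [1 < v]
    only, as ['Z_0] and ['Z_1] have two elements. *)
Definition NC (v : nat) : nat :=
  #|equivalence_partition (@iso 'Z_v)
      [set B : {set {set 'Z_v}} | is_STS B && is_cyclic B]|.

Lemma relabel1 (V : finType) (B : {set {set V}}) : relabel 1%g B = B.
Proof.
rewrite /relabel -[RHS]imset_id; apply: eq_imset => b.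
by rewrite -[RHS]imset_id; apply: eq_imset => x; rewrite perm1.
Qed.

Lemma relabelM (V : finType) (f g : {perm V}) (B : {set {set V}}) :
  relabel (f * g)%g B = relabel g (relabel f B).
Proof.
rewrite /relabel -imset_comp; apply: eq_imset => b /=.
by rewrite -imset_comp; apply: eq_imset => x; rewrite permM.
Qed.

Lemma iso_equiv (V : finType) : equivalence_rel (@iso V).
Proof.
apply/equivalence_relP; split=> [B|B B' /existsP[f /eqP <-] C].
  by apply/existsP; exists 1%g; rewrite relabel1.
apply/existsP/existsP=> -[g /eqP <-].
  by exists (f^-1 * g)%g; rewrite -relabelM mulgA mulgV mul1g.
by exists (f * g)%g; rewrite relabelM.
Qed.

(* Main.v *)
(** A cyclic STS(6n+3) arises from [n] difference triples [a], [b], [a + b] whose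
    entries represent, up to sign modulo [6n+3], all of [1, ..., 3n+1] except
    [2n+1]; each triple may be developed from [{0, a, a + b}] or [{0, b, a + b}].
    For [n = 36 h + r] with [33 <= r < 69], all but [r - 9] triples are grouped
    into [4 h + 1] inflated blocks [a0 + x], [b0 + l x], [a0 + b0 + x + l x] with
    [0 <= x < 9], where [l] is any of the 244 additive permutations of order 9.
    This gives [(244 * 2 ^ 9) ^ (4 h + 1)] distinct systems, about [3.68 ^ n].
    Isomorphism only costs a quasi-polynomial factor: a proper subsystem of an
    STS(v) at least doubles when a point is added, so an automorphism group has
    at most [v ^ (1 + log2 v)] elements, and an isomorphism between systems
    invariant under [x |-> x + 1] is determined by a point and an automorphism. *)

Require Import Defs.
From mathcomp Require Import all_boot all_order all_fingroup all_algebra.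
From mathcomp Require Import zify ring.

Set Implicit Arguments.
Unset Strict Implicit.
Unset Printing Implicit Defensive.

Import GRing.Theory.

(** * Edges of a complete graph *)

Lemma in_edges (V : finType) (A e : {set V}) :
  (e \in edges A) = (e \subset A) && (#|e| == 2).
Proof. by rewrite !inE. Qed.

Lemma edge_in_edges (V : finType) (A : {set V}) x y :
  x != y -> ([set x; y] \in edges A) = (x \in A) && (y \in A).
Proof. by move=> nxy; rewrite in_edges cards2 nxy subUset !sub1set andbT. Qed.

Lemma card_edges (V : finType) (A : {set V}) : #|edges A| = 'C(#|A|, 2).
Proof. by rewrite -cards_draws; apply: eq_card => e; rewrite in_edges !inE. Qed.

Lemma edges_inj3 (V : finType) (b b' : {set V}) :
  #|b| = 3 -> #|b'| = 3 -> edges b = edges b' -> b = b'.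
Proof.
move=> b3 b'3 E; apply/eqP; rewrite eqEcard b3 b'3 leqnn andbT.
apply/subsetP => x xb.
have /card_gt0P[y] : 0 < #|b :\ x| by have := cardsD1 x b; rewrite xb b3; lia.
rewrite !inE => /andP[nyx yb]; have nxy : x != y by rewrite eq_sym.
have : [set x; y] \in edges b by rewrite edge_in_edges // xb yb.
by rewrite E edge_in_edges // => /andP[].
Qed.

(** * Blocks, automorphisms and fixed subsystems of a Steiner triple system *)

Section SteinerTripleSystem.
Variables (V : finType) (B : {set {set V}}).
Hypothesis STS_B : is_STS B.

Lemma STS_card3 b : b \in B -> #|b| = 3.
Proof. by case/andP: STS_B => /forall_inP b3 _ /b3 /eqP. Qed.

Lemma STS_block_ex x y : x != y -> exists2 b, b \in B & (x \in b) && (y \in b).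
Proof.
move=> nxy; case/andP: STS_B => _ /and3P[/eqP covB _ _].
have : [set x; y] \in edges [set: V] by rewrite edge_in_edges // !inE.
rewrite -covB => /bigcupP[_ /imsetP[b bB ->]].
by rewrite edge_in_edges // => xyb; exists b.
Qed.

Lemma STS_block_uniq b b' x y : b \in B -> b' \in B -> x != y ->
  x \in b -> y \in b -> x \in b' -> y \in b' -> b = b'.
Proof.
move=> bB b'B nxy xb yb xb' yb'.
case/andP: STS_B => _ /and3P[_ /trivIsetP tB _].
apply: edges_inj3; rewrite ?STS_card3 //.
apply: contraTeq isT => nE.
have /pred0P/(_ [set x; y]) := tB _ _ (imset_f _ bB) (imset_f _ b'B) nE.
by rewrite /= !edge_in_edges // xb yb xb' yb'.
Qed.

Lemma STS_thirdP x y : x != y ->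
  exists z, [/\ z != x, z != y & [set x; y; z] \in B].
Proof.
move=> nxy; have [b bB /andP[xb yb]] := STS_block_ex nxy.
have b3 := STS_card3 bB.
have /cards1P[z Ez] : #|b :\ x :\ y| == 1.
  have := cardsD1 x b; have := cardsD1 y (b :\ x).
  by rewrite !inE eq_sym nxy xb yb b3; lia.
have : z \in b :\ x :\ y by rewrite Ez set11.
rewrite !inE => /and3P[nzy nzx zb]; exists z; split => //.
suff -> : [set x; y; z] = b by [].
apply/eqP; rewrite eqEcard !subUset !sub1set xb yb zb b3 /=.
rewrite setUC cardsU1 !inE (negPf nzx) (negPf nzy) /=.
by rewrite cards2 nxy.
Qed.

Lemma relabel_block (f : {perm V}) (b : {set V}) :
  b \in B -> [set f x | x in b] \in relabel f B.
Proof. by move=> bB; apply: imset_f. Qed.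

(** The image of the block is a block that still contains [x] and [y], hence the same block; by
    injectivity [f z] can only be [z]. *)
Lemma aut_fix_third (f : {perm V}) x y z : relabel f B = B ->
  [set x; y; z] \in B -> x != y -> z != x -> z != y ->
  f x = x -> f y = y -> f z = z.
Proof.
move=> fB bB nxy nzx nzy fx fy.
have := relabel_block f bB; rewrite fB => fbB.
have Efb : [set f t | t in [set x; y; z]] = [set x; y; z].
  apply: (STS_block_uniq fbB bB nxy); rewrite ?inE ?eqxx ?orbT //.
    by apply/imsetP; exists x; rewrite ?inE ?eqxx.
  by apply/imsetP; exists y; rewrite ?inE ?eqxx ?orbT.
have : f z \in [set x; y; z].
  by rewrite -Efb; apply: imset_f; rewrite !inE eqxx orbT.
rewrite !inE => /orP[/orP[]|] /eqP // fz.
  by case/eqP: nzx; apply: (@perm_inj _ f); rewrite fz fx.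
by case/eqP: nzy; apply: (@perm_inj _ f); rewrite fz fy.
Qed.

Definition aut_set : {set {perm V}} := [set f | relabel f B == B].

Lemma aut_group_set : group_set aut_set.
Proof.
apply/group_setP; split=> [|f g]; first by rewrite inE relabel1.
by rewrite !inE relabelM => /eqP -> /eqP ->.
Qed.
Canonical aut_group := Group aut_group_set.

Local Notation fixed H := ('Fix_('P)(H))%g.

Lemma fixedP (H : {group {perm V}}) x :
  reflect (forall f, f \in H -> f x = x) (x \in fixed H).
Proof. by apply: (iffP afixP) => fixH f /fixH. Qed.

(* The fixed points of a group of automorphisms form a subsystem; stabilising a
   further point [x] adds [x] and the third points of all [x]-[a], [a] fixed. *)
Lemma card_fixed_stab (H : {group {perm V}}) x :
  H \subset aut_group -> x \notin fixed H ->
  (#|fixed H|).*2.+1 <= #|fixed 'C_H[x | 'P]|.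
Proof.
move=> HA nx; set F := fixed H; set F' := fixed _.
have autH f : f \in H -> relabel f B = B.
  by move/(subsetP HA); rewrite inE => /eqP.
have nFx a : a \in F -> x != a by move=> aF; apply: contraNneq nx => ->.
(* The third point of the block through [x] and [a]. The default never occurs for [a] in [F], since
   [x] itself is not fixed. *)
pose t a := odflt x [pick z | [&& z != x, z != a & [set x; a; z] \in B]].
have tP a : a \in F -> [/\ t a != x, t a != a & [set x; a; t a] \in B].
  move=> /nFx/STS_thirdP[z [zx za zB]]; rewrite /t; case: pickP => [w /and3P[]//|].
  by move/(_ z); rewrite zx za zB.
have FF' : F \subset F'.
  by apply/subsetP => a /fixedP aF; apply/fixedP => f /setIP[/aF].
have xF' : x \in F'.
  by apply/fixedP => f /setIP[_]; move/astab1P.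
have tF' : t @: F \subset F'.
  apply/subsetP => _ /imsetP[a aF ->]; have [tx ta tB] := tP a aF.
  apply/fixedP => f fC; apply: (aut_fix_third _ tB) => //; last 2 first.
  - by move/fixedP: xF'; apply.
  - by move/subsetP/(_ a aF)/fixedP: FF'; apply.
  - by case/setIP: fC => /autH.
  - exact: nFx.
(* If a third point [z] were fixed by [H], the block through the fixed points [a] and [z] would
   force [x] to be fixed. *)
have dtF : [disjoint F & t @: F].
  apply/pred0P => z /=; apply/negP => /andP[zF /imsetP[a aF Ez]].
  have [tx ta tB] := tP a aF; rewrite -Ez in tx ta tB.
  case/negP: nx; apply/fixedP => f fH.
  have E : [set x; a; z] = [set a; z; x] by apply/setP => w; rewrite !inE -orbA orbC.
  apply: (aut_fix_third (autH f fH) (x := a) (y := z)); rewrite -?E //.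
  - by rewrite eq_sym.
  - exact: nFx.
  - by rewrite eq_sym.
  - by move/fixedP: aF; apply.
  - by move/fixedP: zF; apply.
have injt : {in F &, injective t}.
  move=> a a' aF a'F Et; have [tx ta tB] := tP a aF; have [tx' ta' tB'] := tP a' a'F.
  have : [set x; a; t a] = [set x; a'; t a'].
    by apply: (STS_block_uniq (x := x) (y := t a)); rewrite 1?eq_sym ?Et ?inE ?eqxx ?orbT // -Et.
  move/setP/(_ a); rewrite !inE eqxx orbT /= => /esym/orP[/orP[]|] /eqP //.
    by move=> Ea; case/eqP: (nFx _ aF).
  by rewrite -Et => Ea; case/eqP: ta.
have ntx : x \notin F :|: t @: F.
  rewrite inE negb_or nx; apply/imsetP => -[a aF Ex].
  by have [/eqP[]] := tP a aF.
have -> : (#|F|).*2.+1 = #|x |: (F :|: t @: F)|.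
  by rewrite cardsU1 ntx cardsU disjoint_setI0 // cards0 subn0 card_in_imset // addnn.
by apply: subset_leq_card; rewrite !subUset sub1set xF' FF' tF'.
Qed.

(** Induction along a chain of point stabilisers: each step at least doubles the number of fixed
    points plus one, by [card_fixed_stab], and its index is the size of an orbit, at most [#|V|]. At
    [j = 0] the hypothesis leaves no moved point, so the group is trivial. *)
Lemma card_aut_le (H : {group {perm V}}) j : 0 < #|V| -> H \subset aut_group ->
  #|V| < 2 ^ j * (#|fixed H|).+1 -> #|H| <= #|V| ^ j.
Proof.
move=> V_gt0; elim: j H => [|j IHj] H HA ltV.
  have FT : fixed H = setT.
    by apply/eqP; rewrite eqEcard subsetT cardsT; move: ltV; rewrite mul1n ltnS.
  suff -> : H :=: 1%g by rewrite cards1.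
  apply/trivgP/subsetP => f fH; rewrite inE; apply/eqP/permP => x.
  have /fixedP xF : x \in fixed H by rewrite FT inE.
  by rewrite perm1 xF.
have [FT|/subsetPn[x _ nx]] := boolP (setT \subset fixed H).
  suff -> : H :=: 1%g.
    by rewrite cards1 expn_gt0 V_gt0.
  apply/trivgP/subsetP => f fH; rewrite inE; apply/eqP/permP => x.
  have /fixedP xF : x \in fixed H by rewrite (subsetP FT) ?inE.
  by rewrite perm1 xF.
have ltF := card_fixed_stab HA nx.
rewrite -(card_orbit_in_stab 'P x (subsetT H)) expnS leq_mul ?max_card //.
apply: IHj => //; first exact: subset_trans (subsetIl _ _) HA.
apply: leq_trans ltV _; rewrite expnS -mulnA mulnCA leq_mul2l.
by apply/orP; right; rewrite mul2n doubleS ltnS.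
Qed.

End SteinerTripleSystem.

(** * Counting isomorphism classes of shift-invariant systems *)

(* An isomorphism [f] from [B0] to a system invariant under the cycle [s] is
   determined by the preimage of [x0] and by [f s f^-1], an automorphism of [B0]. *)
Lemma card_isomorphic_invariant (V : finType) (B0 : {set {set V}})
    (s : {perm V}) (x0 : V) (S : {set {set {set V}}}) (j : nat) :
  is_STS B0 -> (forall x, exists k, (s ^+ k)%g x0 = x) ->
  {in S, forall B, relabel s B = B /\ iso B0 B} ->
  #|V| < 2 ^ j -> #|S| <= #|V| ^ j.+1.
Proof.
move=> STS0 s_trans Sinv ltV.
pose F B : {perm V} := odflt 1%g [pick f : {perm V} | relabel f B0 == B].
have FP B : B \in S -> relabel (F B) B0 = B.
  move=> /Sinv[_ /existsP[f fB]]; rewrite /F; case: pickP => [g /eqP //|].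
  by move/(_ f); rewrite fB.
pose code B := ((F B)^-1%g x0, (F B * s * (F B)^-1)%g).
have code_inj : {in S &, injective code}.
  move=> B B' BS B'S [E1 E2]; suff: F B = F B' by rewrite -{2}(FP B) // -{2}(FP B') // => ->.
  apply/permP => x.
  (* The code yields the inverse of [F C] at each [(s ^+ k) x0], hence everywhere by transitivity of
     [s]. *)
  have pow C k : (((F C * s * (F C)^-1) ^+ k)%g ((F C)^-1%g x0)) = (F C)^-1%g ((s ^+ k)%g x0).
    elim: k => [|k IHk]; first by rewrite !expg0 !perm1.
    by rewrite expgSr permM IHk expgSr !permM permKV.
  have [k Ek] := s_trans (F B x).
  by have := pow B' k; rewrite -E1 -E2 pow Ek permK => E; rewrite [in RHS]E permKV.
have -> : #|S| = #|code @: S| by rewrite card_in_imset.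
apply: (@leq_trans #|setX [set: V] (aut_set B0)|).
  apply: subset_leq_card; apply/subsetP => _ /imsetP[B BS ->].
  rewrite !inE /= !relabelM FP //; have [-> _] := Sinv _ BS.
  by rewrite -[X in relabel _ X](FP B) // -relabelM mulgV relabel1.
have V_gt0 : 0 < #|V| by apply/card_gt0P; exists x0.
rewrite cardsX cardsT expnS leq_mul2l (card_aut_le STS0 (H := aut_group B0)) ?orbT //.
by rewrite (leq_trans ltV) // leq_pmulr.
Qed.

Lemma relabel_shift1 (v : nat) (s : {perm 'Z_v}) (B : {set {set 'Z_v}}) :
  (forall x, s x = (x + 1)%R) ->
  (forall b, b \in B -> forall z, shift z b \in B) -> relabel s B = B.
Proof.
move=> sE Binv; apply/eqP; rewrite eqEcard; apply/andP; split.
  apply/subsetP => _ /imsetP[b bB ->].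
  have -> : [set s x | x in b] = shift 1%R b by apply: eq_imset => x; rewrite sE.
  exact: Binv.
by rewrite card_imset //; apply/imset_inj/perm_inj.
Qed.

(** The members of [S] in one isomorphism class are all isomorphic to a chosen one of them, so
    [card_isomorphic_invariant], with [s] the translation by 1, bounds their number; there are
    [NC v] classes. *)
Lemma NC_ge (v j : nat) (S : {set {set {set 'Z_v}}}) :
  {in S, forall B, is_STS B} ->
  (forall B b, B \in S -> b \in B -> forall z, shift z b \in B) ->
  #|'Z_v| < 2 ^ j -> #|S| <= NC v * #|'Z_v| ^ j.+1.
Proof.
move=> S_STS S_inv ltv.
set D := [set B : {set {set 'Z_v}} | is_STS B && is_cyclic B].
have SD : S \subset D.
  apply/subsetP => B BS; rewrite inE S_STS //=; apply/existsP; exists 1%g.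
  rewrite relabel1; apply/forall_inP => b bB; apply/forallP => z.
  exact: S_inv BS bB _.
have eqvD : {in D & &, equivalence_rel (@iso 'Z_v)}.
  by move=> B1 B2 B3 _ _ _; apply: iso_equiv.
have partD := equivalence_partitionP eqvD.
pose s : {perm 'Z_v} := perm (@GRing.addIr _ (1%R : 'Z_v)).
have sE x : s x = (x + 1)%R by rewrite permE.
have s_trans x : exists k, (s ^+ k)%g (0%R : 'Z_v) = x.
  exists x; rewrite -[RHS]natr_Zp; move: (nat_of_ord x) => k.
  elim: k => [|k IHk]; first by rewrite expg0 perm1.
  by rewrite expgSr permM IHk sE -GRing.mulrSr.
have -> : #|S| = \sum_(B in D | B \in S) 1.
  rewrite sum1dep_card; apply: eq_card => B; rewrite [RHS]inE.
  by case BS: (B \in S); rewrite ?andbF // (subsetP SD).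
rewrite (set_partition_big_cond _ partD) /= -sum_nat_const.
apply: leq_sum => A AP.
have [/pred0P A0|/pred0Pn[B0 /andP[B0A B0S]]] := boolP (pred0b [pred B in A | B \in S]).
  by rewrite big_pred0.
rewrite sum1dep_card.
have B0D := subsetP SD _ B0S.
apply: (@leq_trans #|[set B in S | iso B0 B]|).
  apply: subset_leq_card; apply/subsetP => B; rewrite !inE => /andP[BA BS].
  rewrite BS /=.
  have [_ /trivIsetP tP _] := and3P partD.
  rewrite -(pblock_equivalence_partition eqvD) // ?(subsetP SD) //.
  by rewrite (def_pblock (proj1 (andP (proj2 (andP partD)))) AP).
apply: (@card_isomorphic_invariant _ B0 s 0%R) => //; first exact: S_STS.
move=> B; rewrite inE => /andP[BS isoB]; split=> //.
by apply: (relabel_shift1 sE) => b; apply: S_inv.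
Qed.

Lemma shift3 (v : nat) (t x y z : 'Z_v) :
  shift t [set x; y; z] = [set x + t; y + t; z + t]%R.
Proof. by rewrite /shift !imsetU !imset_set1. Qed.

Lemma cards3 (T : finType) (x y z : T) :
  x != y -> x != z -> y != z -> #|[set x; y; z]| = 3.
Proof.
by move=> xy xz yz; rewrite setUC cardsU1 !inE cards2 xy !(eq_sym z) (negPf xz) (negPf yz).
Qed.

(** * Cyclic systems developed from base blocks *)

Section CyclicFromDifferences.
Local Open Scope ring_scope.
Variables (n : nat) (I : finType).
Local Notation v := (6 * n + 3)%N.
Variables p q : I -> 'Z_v.
Local Notation w := ((2 * n + 1)%:R : 'Z_v).

Definition base_block (z : 'Z_v) (i : I) : {set 'Z_v} :=
  [set z; z + p i; z + q i].
Definition short_block (z : 'Z_v) : {set 'Z_v} := [set z; z + w; z + (w + w)].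
Definition develop : {set {set 'Z_v}} :=
  [set base_block zi.1 zi.2 | zi : 'Z_v * I] :|: [set short_block z | z : 'Z_v].

Lemma develop_shift b : b \in develop -> forall z, shift z b \in develop.
Proof.
move=> bD z; case/setUP: bD => [/imsetP[[t i] _ ->]|/imsetP[t _ ->]].
  rewrite shift3 -(addrAC t z) -(addrAC t z) inE; apply/orP; left.
  by apply/imsetP; exists (t + z, i).
rewrite shift3 -(addrAC t z) -(addrAC t z) inE; apply/orP; right.
by apply/imsetP; exists (t + z).
Qed.

Hypothesis n_gt0 : (0 < n)%N.

Let v_gt1 : (1 < v)%N. Proof. lia. Qed.

Let w3 : w + w + w = 0.
Proof. by rewrite -!natrD -[RHS](@pchar_Zp v) //; congr (_%:R); lia. Qed.

Let w_neq0 : w != 0.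
Proof.
apply/eqP => /(congr1 val); rewrite /= val_Zp_nat // modn_small; lia.
Qed.

Let w2_neq0 : w + w != 0.
Proof.
rewrite -natrD; apply/eqP => /(congr1 val); rewrite /= val_Zp_nat // modn_small; lia.
Qed.

Let cardV : #|[set: 'Z_v]| = v.
Proof. by rewrite cardsT card_ord Zp_cast. Qed.

Lemma short_block_w z : short_block (z + w) = short_block z.
Proof.
rewrite /short_block; apply/setP => x; rewrite !inE.
have -> : z + w + (w + w) = z by rewrite -[RHS]addr0 -w3; ring.
have -> : z + w + w = z + (w + w) by ring.
by rewrite orbC orbA.
Qed.

(** Translation by [w] permutes the points of a short block, so [short_block z] depends only on [z]
    modulo [2 * n + 1]. *)
Lemma card_short_blocks : (#|[set short_block z | z : 'Z_v]| <= 2 * n + 1)%N.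
Proof.
apply: (@leq_trans #|[set short_block (k : 'I_(2 * n + 1))%:R | k : 'I_(2 * n + 1)]|).
  apply: subset_leq_card; apply/subsetP => _ /imsetP[z _ ->].
  have k_lt : (z %% (2 * n + 1) < 2 * n + 1)%N by rewrite ltn_pmod //; lia.
  apply/imsetP; exists (Ordinal k_lt) => //=.
  have Dk d k : short_block (d * (2 * n + 1) + k)%:R = short_block k%:R.
    elim: d => [//|d IHd]; rewrite (mulSn d) -(addnA _ (d * _)%N) natrD.
    by rewrite [w + _]addrC short_block_w.
  by rewrite -{1}[z]natr_Zp {1}(divn_eq z (2 * n + 1)) Dk.
by rewrite (leq_trans (leq_imset_card _ _)) ?card_ord.
Qed.

Hypothesis cardI : #|I| = n.
Hypothesis p_neq0 : forall i, p i != 0.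
Hypothesis q_neq0 : forall i, q i != 0.
Hypothesis pq_neq : forall i, p i != q i.

Definition covered (d : 'Z_v) :=
  exists i, d \in [:: p i; - p i; q i; - q i; p i - q i; q i - p i].

Hypothesis cov : forall d, d != 0 -> d != w -> d != - w -> covered d.

Lemma develop_card3 b : b \in develop -> #|b| = 3.
Proof.
have nadd (z x : 'Z_v) : x != 0 -> z != z + x.
  by move=> x0; rewrite -[X in X != _]addr0 (inj_eq (addrI z)) eq_sym.
have naddd (z x y : 'Z_v) : x != y -> z + x != z + y.
  by rewrite (inj_eq (addrI z)).
case/setUP => [/imsetP[[z i] _ ->]|/imsetP[z _ ->]]; apply: cards3.
- exact: nadd.
- exact: nadd.
- exact: naddd.
- exact: nadd.
- exact: nadd.
- exact/naddd/nadd.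
Qed.

Lemma develop_cover x y : x != y -> exists2 b, b \in develop & (x \in b) && (y \in b).
Proof.
move=> nxy.
have [Ew|nw] := eqVneq (y - x) w.
  exists (short_block x); first by rewrite inE imset_f ?orbT.
  by rewrite !inE eqxx -Ew addrC subrK eqxx !orbT.
have [Ew|nw'] := eqVneq (y - x) (- w).
  exists (short_block y); first by rewrite inE imset_f ?orbT.
  have Ew' : w = x - y by rewrite -(opprK w) -Ew opprB.
  by rewrite !inE eqxx Ew' addrC subrK eqxx !orbT.
have d_neq0 : y - x != 0 by rewrite subr_eq0 eq_sym.
have [i] := cov d_neq0 nw nw'.
have inD z : base_block z i \in develop.
  by rewrite inE; apply/orP; left; apply/imsetP; exists (z, i).
have Ey d : y - x = d -> y = x + d by move=> <-; rewrite addrC subrK.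
rewrite !inE; case/or4P=> [/eqP/Ey->|/eqP/Ey->|/eqP/Ey->|/or3P[]/eqP/Ey->].
- by exists (base_block x i); rewrite // !inE !eqxx ?orbT.
- by exists (base_block (x - p i) i); rewrite // !inE subrK !eqxx ?orbT.
- by exists (base_block x i); rewrite // !inE !eqxx ?orbT.
- by exists (base_block (x - q i) i); rewrite // !inE subrK !eqxx ?orbT.
- exists (base_block (x - q i) i); rewrite // !inE subrK.
  by rewrite [x + _ in X in _ && X]addrA [x + _ - _]addrAC !eqxx ?orbT.
- exists (base_block (x - p i) i); rewrite // !inE subrK.
  by rewrite [x + _ in X in _ && X]addrA [x + _ - _]addrAC !eqxx ?orbT.
Qed.

(* The edges of the blocks cover all edges, and there are at most as many of
   the former as of the latter: so no edge is covered twice. *)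
Lemma develop_STS : is_STS develop.
Proof.
have card3E A : A \in @edges _ @: develop -> #|A| = 3.
  by case/imsetP => b bD ->; rewrite card_edges develop_card3.
apply/andP; split; first by apply/forall_inP => b /develop_card3 ->.
have covT : cover (@edges _ @: develop) = edges [set: 'Z_v].
  apply/setP => e; apply/bigcupP/idP.
    case=> _ /imsetP[b _ ->]; rewrite !in_edges => /andP[_ ->].
    by rewrite subsetT.
  rewrite in_edges => /andP[_ /cards2P[x [y [nxy ->]]]].
  have [b bD /andP[xb yb]] := develop_cover nxy.
  by exists (edges b); rewrite ?imset_f // edge_in_edges // xb yb.
rewrite /partition covT eqxx /=; apply/andP; split; last first.
  by apply/negP => /card3E; rewrite cards0.
have [leC <-] := leq_card_cover (@edges _ @: develop).
rewrite eqn_leq leC /= covT card_edges cardV.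
rewrite (eq_bigr (fun=> 3)) // sum_nat_const.
have leE : (#|@edges 'Z_v @: develop| <= v * n + (2 * n + 1))%N.
  rewrite (leq_trans (leq_imset_card _ _)) //.
  rewrite (leq_trans (leq_card_setU _ _)) // leq_add ?card_short_blocks //.
  by rewrite (leq_trans (leq_imset_card _ _)) // card_prod -cardsT cardV cardI.
(* Three times the bound on the number of blocks is [v * (3 * n + 1)], which is the number of pairs
   of points. *)
rewrite bin2 (@leq_trans ((v * n + (2 * n + 1)) * 3)) ?leq_mul2r ?leE ?orbT //.
by rewrite geq_half_double; nia.
Qed.

End CyclicFromDifferences.

(** * Systems given by difference triples *)

Section DifferenceTriples.
Variables (n : nat) (I : finType).
Local Notation v := (6 * n + 3)%N.

(* A difference triple [a], [b], [a + b] is developed from either of the base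
   blocks {0, a, a + b} and {0, b, a + b}, as told by [o]. *)
Definition triple_system (a b : I -> nat) (o : I -> bool) : {set {set 'Z_v}} :=
  develop (fun i => (if o i then b i else a i)%:R%R : 'Z_v)
          (fun i => (a i + b i)%:R%R : 'Z_v).

Hypothesis n_gt0 : 0 < n.

Let v_gt1 : (1 < v)%N. Proof. lia. Qed.

Let natZ_neq0 k : 0 < k < v -> (k%:R != 0 :> 'Z_v)%R.
Proof.
move=> k_lt; apply/eqP => /(congr1 val) /=.
rewrite val_Zp_nat // modn_small; lia.
Qed.

Lemma natZ_inj k l : k < v -> l < v -> k%:R%R = l%:R%R :> 'Z_v -> k = l.
Proof.
by move=> kv lv /(congr1 val) /=; rewrite !val_Zp_nat // !modn_small.
Qed.

(** The differences of a block are closed under negation and [v] is odd, so representing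
    [1, ..., 3 * n + 1] suffices, with [2 * n + 1] left to the short blocks. The last alternative
    serves sums beyond half of [v], represented by their negatives. *)
Lemma triple_system_STS (a b : I -> nat) (o : I -> bool) : #|I| = n ->
  (forall i, [/\ 0 < a i, 0 < b i & a i + b i < v]) ->
  (forall d, 0 < d <= 3 * n + 1 -> d != 2 * n + 1 ->
     exists i, [|| d == a i, d == b i, d == a i + b i | d + a i + b i == v]) ->
  is_STS (triple_system a b o).
Proof.
move=> cardI abP cov; apply: develop_STS => //.
- by move=> i; have [? ? ?] := abP i; apply: natZ_neq0; case: ifP; lia.
- by move=> i; have [? ? ?] := abP i; apply: natZ_neq0; lia.
- move=> i; have [? ? ?] := abP i; apply/eqP => /natZ_inj E.
  by have := E _ _; case: (o i) E => E0; lia.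
move=> d d0 dw dw'.
have vZ : (v%:R = 0 :> 'Z_v)%R by rewrite pchar_Zp.
pose p i : 'Z_v := (if o i then b i else a i)%:R%R.
pose q i : 'Z_v := (a i + b i)%:R%R.
have covN x : covered p q x -> covered p q (- x)%R.
  case=> i; rewrite !inE => x_i; exists i.
  rewrite !inE -(inj_eq oppr_inj (- x)%R) -(inj_eq oppr_inj (- x)%R (- p i)%R).
  rewrite -(inj_eq oppr_inj (- x)%R (q i)) -(inj_eq oppr_inj (- x)%R (- q i)%R).
  rewrite -(inj_eq oppr_inj (- x)%R (_ - q i)%R) -(inj_eq oppr_inj (- x)%R (_ - p i)%R).
  by rewrite !opprK !opprB; move: x_i; do !case: (_ == _).
have covk k : 0 < k <= 3 * n + 1 -> k != 2 * n + 1 -> covered p q (k%:R)%R.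
  move=> k_le nk; have [i /or4P[]/eqP E] := cov k k_le nk; exists i.
  - rewrite E !inE /p /q natrD.
    by case: (o i); rewrite ?eqxx // addrK eqxx ?orbT.
  - rewrite E !inE /p /q natrD.
    by case: (o i); rewrite ?eqxx // [(_ + (b i)%:R)%R]addrC addrK eqxx ?orbT.
  - by rewrite E !inE eqxx ?orbT.
  - suff -> : (k%:R = - q i)%R by rewrite !inE eqxx ?orbT.
    by apply/eqP; rewrite -subr_eq0 opprK -natrD addnA E vZ.
have d_lt : d < v by have := ltn_ord d; rewrite {2}Zp_cast.
have dE : (d%:R = d :> 'Z_v)%R by rewrite natr_Zp.
have d_gt0 : 0 < d.
  by rewrite lt0n; apply: contraNneq d0 => d_eq0; rewrite -dE d_eq0.
have [k [s [k_le nk Ed]]] : exists k, exists s : bool,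
    [/\ 0 < k <= 3 * n + 1, k != 2 * n + 1 & d = ((-1) ^+ s * k%:R)%R :> 'Z_v].
  case: (leqP d (3 * n + 1)) => [d_le|d_gt].
    exists d, false; rewrite mul1r dE; split; rewrite ?d_gt0 //.
    by apply: contraNneq dw => E; rewrite -dE E.
  have E : d = (- (v - d)%:R)%R.
    by rewrite natrB ?(ltnW d_lt) // vZ sub0r opprK dE.
  exists (v - d), true; rewrite mulN1r; split => //; first lia.
  by apply: contraNneq dw' => E'; rewrite E E'.
by rewrite Ed; case: s {Ed}; rewrite ?expr1 ?mulN1r ?mul1r; [apply: covN|]; apply: covk.
Qed.

(* The third vertex of the block through 0 and [a i] is [a i + b i] or [- b i],
   according to the orientation; these lie in different halves of Z_v. *)
Lemma triple_system_inj (a b b' : I -> nat) (o o' : I -> bool) i :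
  is_STS (triple_system a b o) ->
  triple_system a b o = triple_system a b' o' ->
  0 < a i -> 0 < b i -> 0 < b' i -> a i + b i <= 3 * n + 1 -> a i + b' i <= 3 * n + 1 ->
  b i = b' i /\ o i = o' i.
Proof.
move=> STS E a_gt0 b_gt0 b'_gt0 ab_le ab'_le.
have lt_v c (u : bool) : 0 < c -> a i + c <= 3 * n + 1 ->
    (if u then v - c else a i + c) < v by case: u; lia.
have third_neq0 (u : bool) : (if u then v - b i else a i + b i) != 0.
  by case: u; lia.
have third_neqa (u : bool) : (if u then v - b i else a i + b i) != a i.
  by case: u; lia.
have a_lt : 0 < a i < v by lia.
pose third (c : I -> nat) (u : I -> bool) : 'Z_v :=
  (if u i then - (c i)%:R else (a i + c i)%:R)%R.
have thirdB c u : ([set 0; (a i)%:R; third c u] \in triple_system a c u)%R.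
  rewrite /triple_system /third inE; apply/orP; left; apply/imsetP.
  case ui : (u i).
    exists (- (c i)%:R, i)%R => //=; rewrite /base_block ui natrD addNr addrCA addNr addr0.
    by apply/setP => x; rewrite !inE orbC orbA.
  by exists (0%R, i) => //=; rewrite /base_block ui !add0r.
have natN k : (0 < k < v)%N -> (- k%:R = (v - k)%:R :> 'Z_v)%R.
  by move=> k_lt; rewrite natrB ?pchar_Zp ?sub0r //; lia.
have thirdE c u : 0 < c i -> a i + c i <= 3 * n + 1 ->
    third c u = (if u i then v - c i else a i + c i)%N%:R%R.
  by rewrite /third; case: (u i) => // c0 acle; rewrite natN //; lia.
have Ethird : third b o = third b' o'.
  (* Both blocks pass through 0 and [a i] in the same system, so they coincide, and so do their
     third points. *)
  have B1 := thirdB b o; have B2 := thirdB b' o'; rewrite -E in B2.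
  have Eb := STS_block_uniq STS B1 B2 (x := 0%R) (y := (a i)%:R%R).
  have : third b o \in [set 0; (a i)%:R; third b' o']%R.
    by rewrite -Eb ?inE ?eqxx ?orbT // eq_sym natZ_neq0.
  rewrite !inE thirdE // => /orP[/orP[]|/eqP //] /eqP.
    rewrite -[0%R]/(0%:R)%R => /natZ_inj => /(_ (lt_v _ _ b_gt0 ab_le) (ltnW v_gt1)) /eqP.
    by rewrite (negPf (third_neq0 _)).
  move=> /natZ_inj => /(_ (lt_v _ _ b_gt0 ab_le)); case/andP: a_lt => _ a_lt.
  by move=> /(_ a_lt)/eqP; rewrite (negPf (third_neqa _)).
move: Ethird; rewrite !thirdE // => /natZ_inj E'.
by have := E' _ _; case: (o i) (o' i) E' => [] [] E'; lia.
Qed.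

End DifferenceTriples.

(** * Additive permutations of order 9 *)

(* An additive permutation of order 9 is a permutation [l] of 0, ..., 8 such
   that the sums [x + l x] are 4, ..., 12 in some order. The list
   [partial_additive k] consists of the possible last [k] values of [l]. *)
Fixpoint partial_additive (k : nat) : seq (seq nat) :=
  if k is k'.+1 then
    [seq y :: l | l <- partial_additive k', y <- [seq y <- iota 0 9 |
      [&& y \notin l, 4 <= 8 - k' + y <= 12 &
          8 - k' + y \notin [seq 9 - k' + i + nth 0 l i | i <- iota 0 k']]]]
  else [:: [::]].

Definition additive_perms := partial_additive 9.

Lemma size_additive_perms : size additive_perms = 244.
Proof. by vm_compute. Qed.

Lemma uniq_additive_perms : uniq additive_perms.
Proof. by vm_compute. Qed.

Lemma additive_permP l : l \in additive_perms ->
  [/\ size l = 9, perm_eq l (iota 0 9) &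
      perm_eq [seq x + nth 0 l x | x <- iota 0 9] (iota 4 9)].
Proof.
have/allP H : all (fun l => [&& size l == 9, perm_eq l (iota 0 9) &
      perm_eq [seq x + nth 0 l x | x <- iota 0 9] (iota 4 9)]) additive_perms.
  by vm_compute.
by move/H => /and3P[/eqP].
Qed.

Section AdditivePerm.
Variable l : seq nat.
Hypothesis l_add : l \in additive_perms.

Lemma additive_perm_onto y : y < 9 -> exists2 x, x < 9 & nth 0 l x = y.
Proof.
have [l9 pl _] := additive_permP l_add => y9.
have yl : y \in l by rewrite (perm_mem pl) mem_iota.
by exists (index y l); rewrite ?nth_index // -l9 index_mem.
Qed.

Lemma additive_perm_sum_onto z : z < 9 ->
  exists2 x, x < 9 & x + nth 0 l x = z + 4.
Proof.
have [l9 _ pl] := additive_permP l_add => z9.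
have : z + 4 \in iota 4 9 by rewrite mem_iota; lia.
by rewrite -(perm_mem pl) => /mapP[x]; rewrite mem_iota => x9 ->; exists x.
Qed.

Lemma additive_perm_sum_le x : x < 9 -> x + nth 0 l x <= 12.
Proof.
have [l9 _ pl] := additive_permP l_add => x9.
have : x + nth 0 l x \in iota 4 9.
  by rewrite -(perm_mem pl); apply/mapP; exists x; rewrite // mem_iota.
by rewrite mem_iota; lia.
Qed.

End AdditivePerm.

(** * Leftover difference triples, uniformly in h *)

(* For [n = 36 h + r] the elements of [1, ..., 3n + 1] outside the inflated
   blocks are [9 h w + c], where [c] is the position of the element for [h = 0]
   and the weight [w] counts, in units of [9 h], the inflated blocks before it.
   Here [s] is the number of leftovers before all inflated blocks, and [e] the
   number of positions between the two nests (see [slot] below). *)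
Definition weight (s e c : nat) : nat :=
  if c <= s then 0 else if c <= s + 18 then 2 else
  if c <= 2 * s + 23 then 6 else if c <= 2 * s + 41 then 7 else
  if c <= 2 * s + 41 + e then 8 else 10.

(* The remaining entry of the difference triple with entries [ab.1] and [ab.2]:
   their sum, or the negative of their sum modulo [6n + 3 = 9 h 24 + 6 r + 3]. *)
Definition third (r s e : nat) (ab : nat * nat) : nat :=
  let c := ab.1 + ab.2 in
  if weight s e c == weight s e ab.1 + weight s e ab.2 then c
  else 6 * r + 3 - c.

(** This makes a check at [h = 0] valid for every [h]: the relation between the entries must also
    hold between their weights, where 24 is the weight of [6n + 3]. In the first branch [third] is
    the sum precisely because the weights already agree. *)
Definition third_ok (r s e : nat) (ab : nat * nat) : bool :=
  let c := ab.1 + ab.2 in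
  if weight s e c == weight s e ab.1 + weight s e ab.2 then true else
  weight s e ab.1 + weight s e ab.2 + weight s e (6 * r + 3 - c) == 24.

(** These are the gaps left at [h = 0] by the only inflated block, whose entries fill the nine
    places after [s], the nine after [2s + 41 + e] and the nine after [3s + 46 + e]. *)
Definition leftover_positions (s e : nat) : seq nat :=
  iota 1 s ++ iota (s + 10) (s + 32) ++ iota (2 * s + 42) e ++
  iota (2 * s + 51 + e) (s - 4).

(** The value of [e] makes the sums of the inflated block end at [3r + 1] when [h = 0]. The bounds
    on [2r + 1] give it weight 8, so that it stands for the excluded difference
    [2n + 1 = 72h + 2r + 1]. *)
Definition leftover_ok (r : nat) (d : nat * seq (nat * nat)) : bool :=
  let: (s, T) := d in let e := 3 * r - 3 * s - 54 in
  [&& (4 <= s) && (3 * s + 54 <= 3 * r),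
      2 * s + 42 <= 2 * r + 1 <= 2 * s + 41 + e,
      size T == r - 9,
      all (fun ab => [&& 0 < ab.1 <= 3 * r + 1, 0 < ab.2 <= 3 * r + 1 & third_ok r s e ab]) T &
      sort leq (flatten [seq [:: ab.1; ab.2; third r s e ab] | ab <- T]) ==
      [seq c <- leftover_positions s e | c != 2 * r + 1]].

(* The [i]-th entry, found by computer search, is for [r = 33 + i]. *)
Definition leftover_table : seq (nat * seq (nat * nat)) := [::
 (12, [:: (1,34); (2,72); (3,23); (4,33); (5,22); (6,48); (7,40); (8,31); (9,36);
  (10,55); (11,32); (12,49); (24,66); (25,46); (28,41); (29,44); (30,38);
  (42,70); (50,63); (51,59); (52,62); (53,64); (56,60); (57,58)]);
 (13, [:: (1,37); (2,34); (3,28); (4,25); (5,6); (7,33); (8,53); (9,50); (10,56);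
  (12,35); (13,32); (23,49); (24,46); (26,42); (27,48); (30,43); (39,74);
  (41,76); (44,71); (51,65); (52,62); (54,67); (55,64); (57,63); (58,60)]);
 (13, [:: (1,54); (2,37); (3,35); (4,23); (5,26); (6,53); (7,33); (8,34); (9,32);
  (10,36); (11,56); (12,50); (13,52); (24,73); (25,68); (28,44); (29,48);
  (30,49); (43,76); (45,78); (47,75); (51,66); (57,61); (58,63); (60,64);
  (69,70)]);
 (14, [:: (1,35); (2,12); (3,39); (4,40); (5,27); (6,53); (7,54); (8,37); (9,70);
  (10,33); (11,52); (13,34); (24,74); (25,50); (26,51); (28,71); (29,49);
  (30,46); (31,41); (38,81); (48,80); (55,67); (56,69); (57,66); (58,68);
  (60,64); (62,65)]);
 (16, [:: (1,47); (2,39); (3,35); (4,26); (5,67); (6,27); (7,9); (8,93); (10,40);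
  (11,44); (12,56); (13,36); (14,59); (15,37); (28,54); (29,74); (31,45);
  (32,46); (34,43); (42,81); (51,79); (53,80); (57,69); (58,70); (60,71);
  (61,66); (62,63); (64,65)]);
 (17, [:: (1,33); (2,39); (3,42); (4,13); (5,30); (6,62); (7,94); (8,67); (9,97);
  (10,40); (11,36); (12,43); (14,60); (15,37); (16,38); (27,51); (28,56);
  (29,53); (31,48); (32,49); (44,83); (46,80); (57,76); (58,70); (59,72);
  (61,71); (63,73); (64,65); (66,69)]);
 (17, [:: (1,38); (2,28); (3,14); (4,29); (5,60); (6,36); (7,9); (8,45); (10,37);
  (11,61); (12,59); (13,41); (15,40); (27,81); (31,46); (32,44); (34,48);
  (35,51); (43,87); (49,83); (50,85); (52,84); (56,78); (57,80); (58,75);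
  (62,66); (63,68); (64,74); (67,73); (69,70)]);
 (12, [:: (1,31); (2,33); (3,48); (4,59); (5,57); (6,52); (7,49); (8,53); (9,55);
  (10,50); (11,54); (12,34); (22,85); (23,47); (24,82); (25,80); (26,45);
  (27,42); (28,38); (29,39); (30,37); (36,95); (40,94); (41,92); (43,89);
  (44,91); (72,84); (73,77); (74,83); (75,78); (76,79)]);
 (14, [:: (1,53); (2,60); (3,65); (4,59); (5,52); (6,58); (7,35); (8,61); (9,34);
  (10,56); (11,37); (12,55); (13,33); (14,36); (24,49); (25,82); (26,84);
  (27,81); (28,78); (29,86); (30,44); (31,40); (32,38); (39,96); (41,95);
  (45,92); (47,91); (51,89); (72,87); (75,80); (76,85); (77,79)]);
 (15, [:: (1,36); (2,63); (3,59); (4,56); (5,38); (6,64); (7,35); (8,61); (9,57);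
  (10,41); (11,39); (12,55); (13,58); (14,54); (15,34); (25,88); (26,82);
  (27,84); (28,46); (29,87); (30,79); (31,86); (32,44); (33,40); (45,95);
  (47,94); (48,89); (52,93); (53,90); (72,91); (75,83); (77,80); (78,81)]);
 (15, [:: (1,64); (2,117); (3,38); (4,59); (5,57); (6,37); (7,61); (8,34); (9,36);
  (10,60); (11,56); (12,54); (13,58); (14,55); (15,35); (25,88); (26,49);
  (27,51); (28,48); (29,85); (30,53); (31,80); (32,40); (33,79); (39,101);
  (44,97); (46,100); (47,98); (52,91); (73,89); (74,92); (77,90); (81,84);
  (82,86)]);
 (16, [:: (1,68); (2,39); (3,35); (4,63); (5,61); (6,58); (7,37); (8,62); (9,56);
  (10,77); (11,60); (12,36); (13,40); (14,59); (15,57); (16,81); (26,93);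
  (27,47); (28,90); (29,85); (30,46); (31,84); (32,50); (33,42); (34,83);
  (43,103); (45,98); (49,95); (51,94); (52,99); (54,100); (55,92); (78,88);
  (79,86); (80,91)]);
 (20, [:: (1,74); (2,45); (3,16); (4,112); (5,66); (6,72); (7,42); (8,69); (9,64);
  (10,44); (11,84); (12,68); (13,40); (14,65); (15,43); (17,39); (18,82);
  (20,41); (30,88); (31,93); (32,85); (33,86); (34,89); (35,48); (36,51);
  (37,57); (38,52); (46,101); (50,102); (55,98); (59,92); (60,99); (62,96);
  (63,97); (67,81); (70,76)]);
 (21, [:: (1,69); (2,74); (3,43); (4,68); (5,47); (6,12); (7,10); (8,67); (9,40);
  (11,45); (13,41); (14,116); (15,66); (16,85); (19,84); (20,44); (21,42);
  (31,92); (32,86); (33,91); (34,94); (35,55); (36,53); (37,51); (38,57);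
  (39,48); (50,102); (58,96); (59,98); (60,104); (61,99); (62,97); (65,100);
  (71,82); (73,77); (78,80); (79,83)]);
 (23, [:: (1,117); (2,45); (3,71); (4,75); (5,77); (6,81); (7,12); (8,50); (9,14);
  (10,42); (11,72); (13,119); (15,115); (16,44); (17,51); (18,48); (20,49);
  (21,46); (22,43); (33,88); (34,89); (35,91); (36,97); (37,61); (38,55);
  (39,57); (40,59); (41,53); (54,100); (56,104); (62,101); (63,102); (64,105);
  (70,86); (73,84); (76,85); (78,80); (90,92)]);
 (24, [:: (1,46); (2,65); (3,121); (4,20); (5,51); (6,15); (7,72); (8,74); (9,14);
  (10,73); (11,43); (12,90); (13,45); (16,50); (17,119); (18,44); (19,49);
  (22,48); (34,64); (35,92); (36,95); (37,96); (38,91); (39,55); (40,63);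
  (41,52); (42,57); (53,104); (59,106); (60,101); (61,107); (69,105);
  (71,100); (75,88); (76,80); (77,89); (78,81); (84,85); (86,87)]);
 (22, [:: (1,20); (2,73); (3,42); (4,74); (5,72); (6,41); (7,123); (8,68); (9,71);
  (10,44); (11,127); (12,50); (13,70); (14,51); (15,46); (16,69); (17,43);
  (18,48); (19,92); (22,86); (32,103); (33,93); (34,88); (35,63); (36,53);
  (37,87); (38,90); (39,55); (40,56); (49,112); (52,106); (57,107); (58,110);
  (59,104); (64,101); (67,105); (79,81); (82,84); (91,97); (95,100)]);
 (25, [:: (1,80); (2,77); (3,21); (4,86); (5,125); (6,122); (7,16); (8,74); (9,45);
  (10,12); (11,47); (13,49); (14,126); (15,76); (17,44); (18,124); (19,51);
  (20,48); (25,46); (35,63); (36,56); (37,65); (38,95); (39,60); (40,57);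
  (41,67); (42,52); (43,53); (50,112); (55,111); (59,109); (64,103); (66,106);
  (69,105); (72,104); (73,107); (75,89); (78,87); (83,88); (84,85); (93,100)]);
 (23, [:: (1,81); (2,78); (3,72); (4,79); (5,44); (6,71); (7,47); (8,76); (9,128);
  (10,134); (11,127); (12,73); (13,74); (14,50); (15,42); (16,70); (17,45);
  (18,89); (19,46); (20,94); (21,48); (22,88); (23,43); (33,98); (34,102);
  (35,58); (36,55); (37,95); (38,52); (39,96); (40,101); (41,56); (51,113);
  (53,117); (59,108); (60,109); (61,115); (63,116); (67,99); (68,112);
  (92,106); (100,104)]);
 (26, [:: (1,87); (2,76); (3,47); (4,48); (5,16); (6,18); (7,19); (8,15); (9,77);
  (10,129); (11,79); (12,80); (13,49); (14,51); (17,56); (20,127); (22,46);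
  (25,45); (36,98); (37,96); (38,97); (39,61); (40,55); (41,53); (42,57);
  (43,63); (44,58); (54,117); (59,116); (60,109); (64,108); (66,107);
  (67,112); (69,114); (71,113); (72,115); (74,104); (75,110); (81,89);
  (82,85); (83,91); (84,93); (101,103)]);
 (26, [:: (1,79); (2,49); (3,18); (4,19); (5,130); (6,78); (7,81); (8,47); (9,131);
  (10,52); (11,138); (12,77); (13,50); (14,45); (15,132); (16,76); (17,102);
  (20,53); (22,95); (24,48); (25,46); (26,94); (36,61); (37,105); (38,96);
  (39,65); (40,60); (41,58); (42,56); (43,68); (44,57); (54,116); (64,114);
  (66,109); (67,113); (69,115); (70,118); (74,108); (75,110); (82,91);
  (83,93); (85,86); (87,90); (103,106)]);
 (27, [:: (1,136); (2,24); (3,90); (4,17); (5,81); (6,79); (7,132); (8,83); (9,46);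
  (10,53); (11,78); (12,47); (13,14); (15,51); (16,49); (18,54); (19,48);
  (20,102); (22,97); (23,50); (25,52); (37,101); (38,96); (39,103); (40,58);
  (41,104); (42,64); (43,56); (44,100); (45,62); (57,121); (60,120); (61,112);
  (68,116); (69,110); (70,111); (71,115); (74,113); (75,117); (76,118);
  (80,94); (82,95); (84,92); (87,88); (105,108)]);
 (31, [:: (1,28); (2,88); (3,53); (4,78); (5,20); (6,24); (7,42); (8,58); (9,14);
  (10,21); (11,68); (12,132); (13,62); (15,52); (16,133); (17,135); (18,138);
  (19,50); (22,51); (26,54); (27,57); (41,65); (43,71); (44,64); (45,59);
  (46,70); (47,107); (48,61); (55,121); (60,118); (63,117); (72,113);
  (74,120); (76,110); (77,105); (81,115); (83,119); (85,112); (86,97);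
  (87,101); (89,102); (91,99); (92,100); (93,94); (95,98); (96,103)]);
 (28, [:: (1,89); (2,23); (3,24); (4,83); (5,81); (6,48); (7,85); (8,57); (9,82);
  (10,137); (11,50); (12,140); (13,84); (14,52); (15,141); (16,80); (17,109);
  (18,139); (19,53); (20,49); (21,98); (22,51); (26,99); (28,47); (38,107);
  (39,64); (40,106); (41,71); (42,102); (43,58); (44,60); (45,55); (46,59);
  (56,124); (62,122); (63,127); (67,121); (68,111); (70,116); (74,117);
  (76,120); (77,108); (78,123); (79,118); (88,93); (94,95); (110,114)]);
 (30, [:: (1,26); (2,88); (3,95); (4,144); (5,84); (6,85); (7,53); (8,54); (9,20);
  (10,139); (11,86); (12,49); (13,15); (14,55); (16,56); (17,143); (18,65);
  (19,102); (21,57); (22,52); (23,50); (24,103); (25,138); (30,51); (40,106);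
  (41,67); (42,70); (43,104); (44,63); (45,68); (46,64); (47,109); (48,105);
  (58,125); (59,128); (66,118); (71,119); (75,116); (76,124); (77,117);
  (79,126); (80,123); (82,122); (87,101); (92,94); (93,100); (96,99);
  (111,114)]);
 (31, [:: (1,30); (2,54); (3,26); (4,96); (5,92); (6,141); (7,63); (8,93); (9,86);
  (10,155); (11,87); (12,90); (13,146); (14,89); (15,53); (16,51); (17,140);
  (18,55); (19,142); (20,143); (21,58); (22,105); (23,60); (24,52); (25,59);
  (27,50); (28,57); (41,110); (42,107); (43,119); (44,62); (45,109); (46,65);
  (47,61); (48,66); (49,64); (69,130); (71,122); (72,123); (74,129); (75,116);
  (78,128); (80,118); (81,120); (82,125); (88,99); (91,94); (104,121);
  (112,115)]);
 (33, [:: (1,90); (2,142); (3,27); (4,28); (5,56); (6,96); (7,44); (8,25); (9,57);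
  (10,21); (11,95); (12,71); (13,143); (14,59); (15,148); (16,53); (17,64);
  (18,147); (19,55); (20,110); (22,109); (23,52); (24,54); (26,141); (29,58);
  (43,115); (45,68); (46,70); (47,65); (48,63); (49,72); (50,67); (60,128);
  (62,127); (76,124); (77,126); (79,129); (80,122); (82,114); (84,123);
  (85,120); (86,125); (88,118); (89,108); (92,103); (93,98); (94,99);
  (97,101); (100,104); (105,107)]);
 (34, [:: (1,26); (2,83); (3,105); (4,148); (5,146); (6,28); (7,63); (8,53); (9,21);
  (10,54); (11,22); (12,144); (13,69); (14,59); (15,60); (16,114); (17,111);
  (18,145); (19,149); (20,57); (23,67); (24,62); (25,55); (29,143); (31,58);
  (32,56); (44,71); (45,79); (46,113); (47,110); (48,122); (49,76); (50,66);
  (51,72); (52,65); (68,133); (74,129); (78,118); (81,127); (84,132);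
  (87,126); (91,119); (92,107); (93,104); (94,98); (95,99); (96,106);
  (97,101); (100,109); (102,103); (112,120)]);
 (36, [:: (1,27); (2,145); (3,51); (4,59); (5,144); (6,30); (7,19); (8,84); (9,68);
  (10,146); (11,22); (12,99); (13,18); (14,56); (15,60); (16,57); (17,71);
  (20,67); (21,148); (23,58); (24,150); (25,66); (29,64); (32,62); (34,61);
  (35,55); (46,124); (47,117); (48,72); (49,65); (50,122); (52,121); (53,74);
  (69,125); (76,130); (78,133); (79,131); (80,129); (82,126); (83,118);
  (85,132); (86,128); (89,115); (96,106); (97,110); (98,100); (101,102);
  (103,112); (104,108); (105,113); (107,109); (116,119)]);
 (35, [:: (1,100); (2,30); (3,75); (4,20); (5,26); (6,153); (7,61); (8,149); (9,56);
  (10,25); (11,123); (12,152); (13,21); (14,67); (15,18); (16,58); (17,55);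
  (19,69); (22,57); (23,54); (27,59); (28,62); (29,148); (45,113); (46,115);
  (47,73); (48,70); (49,63); (50,64); (51,117); (52,76); (53,71); (60,137);
  (66,135); (80,122); (82,130); (83,132); (84,119); (85,136); (87,138);
  (89,121); (91,129); (92,127); (93,131); (94,106); (95,109); (96,103);
  (97,108); (98,110); (99,107); (102,111); (104,105); (116,126)]);
 (37, [:: (1,92); (2,154); (3,161); (4,31); (5,32); (6,61); (7,150); (8,19); (9,59);
  (10,98); (11,23); (12,60); (13,74); (14,122); (15,21); (16,63); (17,64);
  (18,153); (20,71); (22,151); (24,66); (25,58); (26,69); (28,152); (29,57);
  (30,149); (33,56); (47,128); (48,84); (49,70); (50,73); (51,75); (52,124);
  (53,77); (54,80); (55,62); (65,135); (76,139); (78,129); (82,131); (85,137);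
  (88,133); (94,120); (96,116); (97,121); (99,110); (100,104); (101,102);
  (103,113); (105,106); (107,112); (109,114); (111,115); (118,125)]);
 (38, [:: (1,73); (2,160); (3,108); (4,152); (5,110); (6,59); (7,27); (8,153); (9,60);
  (10,22); (11,26); (12,23); (13,103); (14,24); (15,118); (16,61); (17,164);
  (18,159); (19,68); (20,70); (21,57); (25,151); (28,63); (29,154); (30,66);
  (31,67); (33,62); (36,58); (48,79); (49,86); (50,120); (51,75); (52,71);
  (53,72); (54,80); (55,76); (56,124); (64,141); (81,140); (82,121); (83,137);
  (84,138); (85,128); (88,136); (89,130); (92,122); (93,139); (97,132);
  (99,119); (100,112); (101,114); (102,106); (104,105); (107,109); (113,117)]);
 (38, [:: (1,37); (2,33); (3,26); (4,110); (5,156); (6,109); (7,59); (8,165); (9,158);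
  (10,24); (11,101); (12,20); (13,62); (14,163); (15,21); (16,160); (17,63);
  (18,60); (19,70); (22,64); (23,164); (25,57); (27,58); (28,154); (30,61);
  (31,67); (48,72); (49,69); (50,92); (51,83); (52,73); (53,68); (54,65);
  (55,74); (56,71); (76,139); (77,136); (79,135); (81,126); (84,128);
  (87,140); (88,143); (90,133); (93,132); (94,144); (95,123); (96,138);
  (97,124); (99,137); (100,108); (102,117); (103,107); (104,105); (106,116);
  (111,113); (122,130)]);
 (39, [:: (1,114); (2,58); (3,34); (4,79); (5,102); (6,161); (7,156); (8,28); (9,29);
  (10,22); (11,168); (12,27); (13,170); (14,158); (15,72); (16,103); (17,171);
  (18,77); (19,63); (20,68); (21,159); (23,62); (24,160); (25,65); (26,164);
  (30,59); (31,69); (33,61); (35,66); (49,78); (50,75); (51,91); (52,71);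
  (53,76); (54,70); (55,80); (56,64); (57,73); (67,146); (74,140); (81,131);
  (84,126); (86,136); (92,145); (93,141); (96,137); (97,128); (98,132);
  (99,143); (104,117); (105,113); (106,118); (108,109); (110,116); (111,112);
  (121,134); (122,138)]);
 (39, [:: (1,168); (2,162); (3,30); (4,27); (5,108); (6,78); (7,163); (8,103); (9,25);
  (10,26); (11,64); (12,104); (13,67); (14,60); (15,159); (16,160); (17,22);
  (18,19); (20,59); (21,161); (23,66); (24,166); (28,70); (29,58); (32,61);
  (35,62); (38,63); (49,76); (50,73); (51,121); (52,68); (53,69); (54,95);
  (55,81); (56,72); (57,83); (65,148); (71,147); (77,137); (82,145); (85,132);
  (86,146); (88,124); (90,134); (91,131); (92,142); (94,127); (96,144);
  (99,139); (100,130); (102,117); (105,115); (106,110); (107,118); (109,119);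
  (112,114); (126,138); (129,133)]);
 (40, [:: (1,112); (2,35); (3,174); (4,28); (5,166); (6,71); (7,33); (8,172); (9,65);
  (10,62); (11,19); (12,173); (13,26); (14,161); (15,63); (16,162); (17,21);
  (18,61); (20,164); (22,66); (23,123); (24,75); (25,163); (27,64); (29,69);
  (31,70); (34,60); (36,59); (50,85); (51,87); (52,76); (53,81); (54,73);
  (55,67); (56,80); (57,82); (58,83); (68,148); (84,145); (86,133); (89,126);
  (90,130); (92,125); (93,149); (96,150); (97,144); (100,143); (102,142);
  (103,132); (104,114); (105,116); (106,118); (107,115); (108,117); (109,119);
  (110,120); (111,121); (124,140); (129,131)])].

Lemma leftover_table_ok i : i < 36 ->
  leftover_ok (33 + i) (nth (0, [::]) leftover_table i).
Proof.
move=> i36.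
have /allP H : all (fun i => leftover_ok (33 + i) (nth (0, [::]) leftover_table i))
  (iota 0 36) by vm_compute.
by apply: H; rewrite mem_iota.
Qed.

(** * Inflated systems of order 6(36h + r) + 3 *)

Section Inflation.
Variables (h r s : nat) (T : seq (nat * nat)).
Hypothesis T_ok : leftover_ok r (s, T).
Local Notation e := (3 * r - 3 * s - 54).
Local Notation n := (36 * h + r).
Local Notation v := (6 * n + 3).

Definition element (c : nat) : nat := 9 * h * weight s e c + c.

(* The [t]-th inflated block consists of the nine difference triples
   [small_start t + x], [middle_start t + l x] and their sum, with [l] an
   additive permutation. The small entries fill consecutive slots of length 9.
   The blocks [t <= 2 h] use the even slots, the others the odd ones; in each
   family the middle entries go down and the sums go up by 9 as [t] increases,
   so they are nested. The slot [2 h + 1] is skipped, which breaks the second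
   nest by a gap of 18: without it an odd number of leftovers would have odd
   weight, whereas every difference triple has an even number of them. *)
Definition slot (t : nat) : nat :=
  if t <= 2 * h then 2 * t else
  if t <= 3 * h then 2 * (t - (2 * h + 1)) + 1 else 2 * (t - (2 * h + 1)) + 3.

Lemma slotA t : t <= 2 * h -> slot t = 2 * t.
Proof. by rewrite /slot => ->. Qed.

Lemma slotP_inner j : j < h -> slot (2 * h + 1 + j) = 2 * j + 1.
Proof. by move=> j_lt; rewrite /slot; case: leqP => [|_]; [|case: leqP]; lia. Qed.

Lemma slotP_outer j : h <= j -> slot (2 * h + 1 + j) = 2 * j + 3.
Proof. by move=> j_ge; rewrite /slot; case: leqP => [|_]; [|case: leqP]; lia. Qed.

Definition small_start (t : nat) : nat := s + 1 + 9 * slot t.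

Definition middle_start (t : nat) : nat :=
  if t <= 2 * h then 90 * h + 2 * s + 42 + e - 9 * t
  else 54 * h + s + 10 - 9 * (t - (2 * h + 1)).

Lemma middle_startA t :
  t <= 2 * h -> middle_start t = 90 * h + 2 * s + 42 + e - 9 * t.
Proof. by rewrite /middle_start => ->. Qed.

Lemma middle_startP j : middle_start (2 * h + 1 + j) = 54 * h + s + 10 - 9 * j.
Proof. by rewrite /middle_start; case: leqP => ?; lia. Qed.

Local Notation index := ('I_(4 * h + 1) * 'I_9 + 'I_(size T))%type.
Local Notation choice :=
  {ffun 'I_(4 * h + 1) -> 'I_(size additive_perms) * {ffun 'I_9 -> bool}}.

Definition perm_at (f : choice) (t : 'I_(4 * h + 1)) : seq nat :=
  nth [::] additive_perms (f t).1.

Definition first_diff (i : index) : nat :=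
  match i with
  | inl (t, x) => small_start t + x
  | inr k => element (nth (0, 0) T k).1
  end.

Definition second_diff (f : choice) (i : index) : nat :=
  match i with
  | inl (t, x) => middle_start t + nth 0 (perm_at f t) x
  | inr k => element (nth (0, 0) T k).2
  end.

Definition orientation (f : choice) (i : index) : bool :=
  if i is inl (t, x) then (f t).2 x else false.

Definition inflated (f : choice) : {set {set 'Z_v}} :=
  triple_system n first_diff (second_diff f) (orientation f).

Let s_ge4 : 4 <= s. Proof. by case/and5P: T_ok => /andP[]. Qed.
Let s_le : 3 * s + 54 <= 3 * r. Proof. by case/and5P: T_ok => /andP[]. Qed.
Let r_ge : 2 * s + 42 <= 2 * r + 1. Proof. by case/and5P: T_ok => _ /andP[]. Qed.
Let r_le : 2 * r + 1 <= 2 * s + 41 + e. Proof. by case/and5P: T_ok => _ /andP[]. Qed.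
Let size_T : size T = r - 9. Proof. by case/and5P: T_ok => _ _ /eqP. Qed.

Let T_bounds ab : ab \in T ->
  [/\ 0 < ab.1 <= 3 * r + 1, 0 < ab.2 <= 3 * r + 1 & third_ok r s e ab].
Proof. by case/and5P: T_ok => _ _ _ /allP H _ /H /and3P[]. Qed.

Lemma card_index : #|{: index}| = n.
Proof. by rewrite card_sum card_prod !card_ord size_T; lia. Qed.

Lemma perm_at_additive f t : perm_at f t \in additive_perms.
Proof. exact: mem_nth. Qed.

Lemma weight_le10 c : weight s e c <= 10.
Proof. by rewrite /weight; do 5!case: ifP => _ //. Qed.

Lemma element_bounds c : 0 < c <= 3 * r + 1 -> 0 < element c <= 3 * n + 1.
Proof. rewrite /element => c_le; have := leq_mul (leqnn (9 * h)) (weight_le10 c).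
by move: (9 * h * weight _ _ _); lia. Qed.

Definition hits (f : choice) (d : nat) : Prop :=
  exists i, [|| d == first_diff i, d == second_diff f i,
    d == first_diff i + second_diff f i |
    d + first_diff i + second_diff f i == v].

Lemma leftover_hit f c : c \in leftover_positions s e -> c != 2 * r + 1 ->
  hits f (element c).
Proof.
move=> c_pos nc.
have : c \in flatten [seq [:: ab.1; ab.2; third r s e ab] | ab <- T].
  case/and5P: T_ok => _ _ _ _ /eqP E.
  by rewrite -(mem_sort leq) E mem_filter nc.
case/flatten_mapP => ab abT; have [ab1 ab2 abT3] := T_bounds abT.
pose k : 'I_(size T) := Ordinal (etrans (index_mem ab T) abT).
have Ek : nth (0, 0) T k = ab by apply: nth_index.
rewrite !inE => c_ab; exists (inr k); rewrite /= Ek.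
case/or3P: c_ab => /eqP ->; rewrite ?eqxx ?orbT //.
move: abT3; rewrite /third /third_ok /element; case: eqP => [-> _|_ /eqP W].
  by apply/or4P/Or43/eqP; lia.
apply/or4P/Or44/eqP.
have -> : v = 9 * h * (weight s e ab.1 + weight s e ab.2 +
    weight s e (6 * r + 3 - (ab.1 + ab.2))) + (6 * r + 3) by rewrite W; lia.
have : 6 * r + 3 - (ab.1 + ab.2) + (ab.1 + ab.2) = 6 * r + 3 by lia.
move: (6 * r + 3 - _) => c'.
move: (weight _ _ c') (weight _ _ ab.1) (weight _ _ ab.2).
by move: (ab.1) (ab.2) => a b w1 w2 w3; rewrite !mulnDr; lia.
Qed.

Lemma first_hit f t x : t < 4 * h + 1 -> x < 9 -> hits f (small_start t + x).
Proof.
by move=> t_lt x_lt; exists (inl (Ordinal t_lt, Ordinal x_lt)); rewrite eqxx.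
Qed.

Lemma second_hit f t y : t < 4 * h + 1 -> y < 9 -> hits f (middle_start t + y).
Proof.
move=> t_lt y_lt.
have [x x_lt Ex] := additive_perm_onto (perm_at_additive f (Ordinal t_lt)) y_lt.
by exists (inl (Ordinal t_lt, Ordinal x_lt)); rewrite /= Ex eqxx orbT.
Qed.

(** The sums [x + l x] run through 4, ..., 12, hence the offset 4. *)
Lemma sum_hit f t z : t < 4 * h + 1 -> z < 9 ->
  hits f (small_start t + middle_start t + 4 + z).
Proof.
move=> t_lt z_lt.
have [x x_lt Ex] := additive_perm_sum_onto (perm_at_additive f (Ordinal t_lt)) z_lt.
exists (inl (Ordinal t_lt, Ordinal x_lt)); apply/or4P/Or43/eqP => /=; lia.
Qed.

(** The range is cut into runs, in increasing order: leftovers of weight 0; small entries; middle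
    entries of the second nest; weight 6; its inner sums; weight 7, filling its gap of 18; its outer
    sums; weight 8; middle entries of the first nest; weight 10; sums of the first nest. *)
Lemma all_hit f d : 0 < d <= 3 * n + 1 -> d != 2 * n + 1 -> hits f d.
Proof.
move=> d_le nd.
have lo c k : c \in leftover_positions s e -> c != 2 * r + 1 ->
    weight s e c = k -> d = 9 * h * k + c -> hits f d.
  by move=> c1 c2 Ek ->; rewrite -Ek; apply: leftover_hit.
have pos c : [|| 0 < c <= s, s + 10 <= c <= 2 * s + 41,
    2 * s + 42 <= c <= 2 * s + 41 + e | 2 * s + 51 + e <= c <= 3 * s + 46 + e] ->
    c \in leftover_positions s e.
  by rewrite !mem_cat !mem_iota; lia.
have fi t x : t < 4 * h + 1 -> x < 9 -> d = small_start t + x -> hits f d.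
  by move=> ? ? ->; apply: first_hit.
have se t x : t < 4 * h + 1 -> x < 9 -> d = middle_start t + x -> hits f d.
  by move=> ? ? ->; apply: second_hit.
have su t x : t < 4 * h + 1 -> x < 9 ->
    d = small_start t + middle_start t + 4 + x -> hits f d.
  by move=> ? ? ->; apply: sum_hit.
have mod9 m : m %% 9 < 9 by rewrite ltn_pmod.
case: (leqP d s) => [d1|d1].
  by apply: (lo d 0); rewrite ?pos /weight; do 5?case: ifP => ?; lia.
case: (leqP d (s + 36 * h + 18)) => [d2|d2].
  have Ed := divn_eq (d - s - 1) 9; have := mod9 (d - s - 1).
  move: Ed; set i := _ %/ 9; set x := _ %% 9 => Ed x_lt.
  (* The skipped slot is filled by leftovers of weight 2. *)
  have [Ei|ni] := eqVneq i (2 * h + 1).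
    by apply: (lo (d - 18 * h) 2); rewrite ?pos /weight; do 5?case: ifP => ?; lia.
  have Ei := odd_double_half i; case: (odd i) Ei => Ei.
    have [i_le|i_gt] := ltnP i./2 h.
      apply: (fi (2 * h + 1 + i./2) x) => //; first lia.
      by rewrite /small_start slotP_inner //; lia.
    apply: (fi (2 * h + 1 + (i./2 - 1)) x) => //; first lia.
    by rewrite /small_start slotP_outer; lia.
  apply: (fi i./2 x) => //; first lia.
  by rewrite /small_start slotA; lia.
case: (leqP d (s + 54 * h + 18)) => [d3|d3].
  (* Middle entries go down as the block index grows, so [d] is measured from the top of the run and
     has offset [8 - x] in its block. *)
  have Ed := divn_eq (s + 54 * h + 18 - d) 9; have := mod9 (s + 54 * h + 18 - d).
  move: Ed; set i := _ %/ 9; set x := _ %% 9 => Ed x_lt.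
  apply: (se (2 * h + 1 + i) (8 - x)); try lia.
  by rewrite middle_startP; lia.
case: (leqP d (2 * s + 54 * h + 23)) => [d4|d4].
  by apply: (lo (d - 54 * h) 6); rewrite ?pos /weight; do 5?case: ifP => ?; lia.
case: (leqP d (2 * s + 63 * h + 23)) => [d5|d5].
  have Ed := divn_eq (d - (2 * s + 54 * h + 24)) 9.
  have := mod9 (d - (2 * s + 54 * h + 24)).
  move: Ed; set i := _ %/ 9; set x := _ %% 9 => Ed x_lt.
  apply: (su (2 * h + 1 + i) x) => //; first lia.
  by rewrite /small_start slotP_inner ?middle_startP; lia.
case: (leqP d (2 * s + 63 * h + 41)) => [d6|d6].
  by apply: (lo (d - 63 * h) 7); rewrite ?pos /weight; do 5?case: ifP => ?; lia.
case: (leqP d (2 * s + 72 * h + 41)) => [d7|d7].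
  have Ed := divn_eq (d - (2 * s + 63 * h + 42)) 9.
  have := mod9 (d - (2 * s + 63 * h + 42)).
  move: Ed; set i := _ %/ 9; set x := _ %% 9 => Ed x_lt.
  apply: (su (2 * h + 1 + (h + i)) x) => //; first lia.
  by rewrite /small_start slotP_outer ?middle_startP; lia.
case: (leqP d (2 * s + 72 * h + 41 + e)) => [d8|d8].
  by apply: (lo (d - 72 * h) 8); rewrite ?pos /weight; do 5?case: ifP => ?; lia.
case: (leqP d (2 * s + 90 * h + 50 + e)) => [d9|d9].
  have Ed := divn_eq (2 * s + 90 * h + 50 + e - d) 9.
  have := mod9 (2 * s + 90 * h + 50 + e - d).
  move: Ed; set i := _ %/ 9; set x := _ %% 9 => Ed x_lt.
  apply: (se i (8 - x)); try lia.
  by rewrite middle_startA; lia.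
case: (leqP d (3 * s + 90 * h + 46 + e)) => [d10|d10].
  by apply: (lo (d - 90 * h) 10); rewrite ?pos /weight; do 5?case: ifP => ?; lia.
have Ed := divn_eq (d - (3 * s + 90 * h + 47 + e)) 9.
have := mod9 (d - (3 * s + 90 * h + 47 + e)).
move: Ed; set i := _ %/ 9; set x := _ %% 9 => Ed x_lt.
apply: (su i x) => //; first lia.
by rewrite /small_start slotA ?middle_startA; lia.
Qed.

(** Here 12 is the largest value of [x + l x]. The bound [3n + 1], attained at [t = 2h], keeps the
    sums in the lower half of Z_v, as [triple_system_inj] requires. *)
Lemma inflated_bounds t x y : t < 4 * h + 1 -> x + y <= 12 ->
  [/\ 0 < small_start t + x, 0 < middle_start t + y &
      small_start t + x + (middle_start t + y) <= 3 * n + 1].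
Proof.
move=> t_lt xy_le; rewrite /small_start.
have [t_le|t_gt] := leqP t (2 * h).
  by rewrite slotA // middle_startA //; split; lia.
have [j Ej] : exists j, t = 2 * h + 1 + j by exists (t - (2 * h + 1)); lia.
subst t.
rewrite middle_startP.
have [j_lt|j_ge] := ltnP j h; first by rewrite slotP_inner //; split; lia.
by rewrite slotP_outer //; split; lia.
Qed.

Lemma diff_bounds f i :
  [/\ 0 < first_diff i, 0 < second_diff f i & first_diff i + second_diff f i < v].
Proof.
case: i => [[t x]|k] /=.
  have xy := additive_perm_sum_le (perm_at_additive f t) (ltn_ord x).
  by have [? ? ?] := inflated_bounds (ltn_ord t) xy; split => //; lia.
have [/element_bounds a_bd /element_bounds b_bd _] :=
  T_bounds (mem_nth (0, 0) (ltn_ord k)).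
by move: (element _) (element _) a_bd b_bd => a b a_bd b_bd; split; lia.
Qed.

Lemma inflated_STS f : is_STS (inflated f).
Proof.
apply: triple_system_STS; [lia | exact: card_index | exact: diff_bounds |].
exact: all_hit.
Qed.

(** [triple_system_inj] recovers the second entry and the orientation of each inflated triple. The
    second entries give the permutation, and this gives its index because [additive_perms] has no
    repetition. *)
Lemma inflated_inj : injective inflated.
Proof.
move=> f f' Eff'; apply/ffunP => t.
have Etx (x : 'I_9) : nth 0 (perm_at f t) x = nth 0 (perm_at f' t) x /\ (f t).2 x = (f' t).2 x.
  have bound g : first_diff (inl (t, x)) + second_diff g (inl (t, x)) <= 3 * n + 1.
    have xy := additive_perm_sum_le (perm_at_additive g t) (ltn_ord x).
    by have [_ _] := inflated_bounds (ltn_ord t) xy.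
  have [E1 E2] : second_diff f (inl (t, x)) = second_diff f' (inl (t, x)) /\
      orientation f (inl (t, x)) = orientation f' (inl (t, x)).
    have [a0 b0 _] := diff_bounds f (inl (t, x)).
    have [_ b0' _] := diff_bounds f' (inl (t, x)).
    have n_gt0 : 0 < n by lia.
    have STS_f := inflated_STS f.
    by have := triple_system_inj n_gt0 STS_f Eff' a0 b0 b0' (bound f) (bound f').
  by split => //; move: E1 => /= /addnI.
have Eperm : perm_at f t = perm_at f' t.
  have [l9 _ _] := additive_permP (perm_at_additive f t).
  have [l9' _ _] := additive_permP (perm_at_additive f' t).
  apply: (@eq_from_nth _ 0) => [|x]; rewrite l9 ?l9' // => x_lt.
  by have [] := Etx (Ordinal x_lt).
have E1 : (f t).1 = (f' t).1.
  have := nth_uniq [::] (ltn_ord (f t).1) (ltn_ord (f' t).1) uniq_additive_perms.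
  by rewrite -/(perm_at f t) -/(perm_at f' t) Eperm eqxx => /esym/eqP/ord_inj.
have E2 : (f t).2 = (f' t).2 by apply/ffunP => x; have [] := Etx x.
rewrite [LHS]surjective_pairing [RHS]surjective_pairing E1 E2.
exact: erefl.
Qed.

Lemma card_choice : #|{: choice}| = (244 * 2 ^ 9) ^ (4 * h + 1).
Proof.
by rewrite card_ffun card_prod card_ffun !card_ord card_bool size_additive_perms.
Qed.

End Inflation.

(** * Numerical estimates and the final bound *)

(** With [2 ^ j.-1 <= 6n + 3 = 216h + 6r + 3], division by 54 yields [j(j + 1) + 2r <= 4h]; the
    constant 145 absorbs the terms in [r], which is at most 68. *)
Lemma quadratic_le_exp j : 16 <= j -> 54 * (j * j.+1 + 145) <= 2 ^ j.-1.
Proof.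
case: j => // j; rewrite /= ltnS => j_ge.
have {j_ge}[k ->] : exists k, j = 15 + k by exists (j - 15); lia.
elim: k => [|k IHk]; first by rewrite addn0; lia.
rewrite addnS expnS; move: (2 ^ _) IHk => w; nia.
Qed.

Lemma NC_inflated (h r s : nat) (T : seq (nat * nat)) (j : nat) :
  leftover_ok r (s, T) -> 6 * (36 * h + r) + 3 < 2 ^ j ->
  (244 * 2 ^ 9) ^ (4 * h + 1) <= NC (6 * (36 * h + r) + 3) * 2 ^ (j * j.+1).
Proof.
move=> T_ok v_lt; set v := 6 * (36 * h + r) + 3 in v_lt *.
have v_gt1 : 1 < v.
  have n_gt0 : 0 < 36 * h + r by case/and3P: T_ok => /andP[]; lia.
  by rewrite /v; lia.
have cardV : #|'Z_v| = v by rewrite card_ord Zp_cast.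
rewrite -(card_choice h) -cardsT -(card_imset _ (inflated_inj T_ok)).
apply: leq_trans (_ : NC v * #|'Z_v| ^ j.+1 <= _).
  apply: NC_ge; last by rewrite cardV.
    by move=> _ /imsetP[f _ ->]; apply: inflated_STS.
  by move=> _ b /imsetP[f _ ->]; apply: develop_shift.
by rewrite leq_mul2l cardV expnM leq_exp2r // (ltnW v_lt) orbT.
Qed.

(** Each block of nine triples offers [z] choices against a target of [(x / y) ^ 9], with a factor 2
    to spare. The [4h] spare factors pay for the isomorphism loss [2 ^ a] and for the [r] remaining
    triples, at most 4 for each since [x <= 4y]. *)
Lemma exp_le_of_base (x y z m a h r : nat) :
  2 * x ^ 9 <= z * y ^ 9 -> x <= y * 2 ^ 2 ->
  z ^ (4 * h) <= m * 2 ^ a -> a + 2 * r <= 4 * h ->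
  x ^ (36 * h + r) <= m * y ^ (36 * h + r).
Proof.
move=> xz xy zm a_le.
have E36 : 36 * h = 9 * (4 * h) by lia.
rewrite -(@leq_pmul2l (2 ^ (4 * h))) ?expn_gt0 //.
have xr : x ^ r <= y ^ r * 2 ^ (2 * r).
  by rewrite expnM -expnMn; case: (r) => // r'; rewrite leq_exp2r.
have xh : 2 ^ (4 * h) * x ^ (36 * h) <= z ^ (4 * h) * y ^ (36 * h).
  by rewrite E36 !(expnM _ 9) -!expnMn; case: (4 * h) => // k; rewrite leq_exp2r.
rewrite [x ^ (_ + _)]expnD [y ^ (_ + _)]expnD (mulnA (2 ^ _)).
apply: leq_trans (leq_mul xh xr) _.
apply: (@leq_trans (m * 2 ^ a * y ^ (36 * h) * (y ^ r * 2 ^ (2 * r)))).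
  by rewrite !leq_mul.
have -> : m * 2 ^ a * y ^ (36 * h) * (y ^ r * 2 ^ (2 * r)) =
  2 ^ (a + 2 * r) * (m * (y ^ (36 * h) * y ^ r)) by rewrite expnD; ring.
by rewrite leq_mul2r leq_exp2l ?a_le ?orbT.
Qed.

Lemma NC_exp_ge n : 2 ^ 13 <= n -> 67 ^ n <= NC (6 * n + 3) * 20 ^ n.
Proof.
move=> n_ge; have n_ge33 : 33 <= n by apply: leq_trans n_ge; lia.
have [h [i [i_lt En]]] : exists h i, i < 36 /\ n = 36 * h + (33 + i).
  exists ((n - 33) %/ 36), ((n - 33) %% 36); rewrite ltn_pmod //.
  by have := divn_eq (n - 33) 36; lia.
have := leftover_table_ok i_lt; case: (nth _ _ _) => s T T_ok.
(* [j] is the binary length of the order; [n >= 2 ^ 13] makes the order exceed [2 ^ 15]. *)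
have [j j_ge [v_ge v_lt]] : exists2 j, 16 <= j &
    2 ^ j.-1 <= 6 * n + 3 /\ 6 * n + 3 < 2 ^ j.
  have v_gt0 : 0 < 6 * n + 3 by lia.
  have /andP[v_ge v_lt] := trunc_log_bounds (isT : 1 < 2) v_gt0.
  exists (trunc_log 2 (6 * n + 3)).+1 => //; rewrite ltnNge ltnS; apply/negP => j_le.
  have : 2 ^ (trunc_log 2 (6 * n + 3)).+1 <= 2 ^ 15 by rewrite leq_exp2l.
  by move: v_lt n_ge; move: (2 ^ _.+1) => w; lia.
have h_ge : j * j.+1 + 2 * (33 + i) <= 4 * h.
  by have := leq_trans (quadratic_le_exp j_ge) v_ge; lia.
(* The ratio [67 / 20] is 3.35, and twice its ninth power is about 106300, below
   [244 * 2 ^ 9 = 124928]. *)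
have base : 2 * 67 ^ 9 <= 244 * 2 ^ 9 * 20 ^ 9 by lia.
have X_gt0 : 0 < 244 * 2 ^ 9 by lia.
rewrite En in v_lt *.
(* One of the [4h + 1] blocks is given up to reach the exponent [4h]. *)
have NC_h := leq_trans (leq_pexp2l X_gt0 (leq_addr 1 (4 * h)))
  (NC_inflated T_ok v_lt).
have le67 : 67 <= 20 * 2 ^ 2 by [].
exact: exp_le_of_base base le67 NC_h h_ge.
Qed.

Import Order.TTheory Num.Theory.
Local Open Scope ring_scope.

Theorem proposition3 :
  exists N : nat, forall n : nat, (N <= n)%N ->
    ((n %% 28)%N \in [:: 3; 5; 24; 26]%N ->
       (335%:R / 100%:R) ^+ n <= (NC (6 * n + 3))%:R :> rat)
    /\
    ((n %% 28)%N \notin [:: 3; 5; 24; 26]%N ->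
       (249%:R / 100%:R) ^+ n <= (NC (6 * n + 3))%:R :> rat).
Proof.
exists (2 ^ 13)%N => n n_ge.
(* Both cases follow from the bound with base 3.35, taking [c] to be 335 or 249. *)
have bound (c : nat) : (c <= 335)%N ->
    (c%:R / 100%:R) ^+ n <= (NC (6 * n + 3))%:R :> rat.
  move=> c_le; rewrite expr_div_n -!natrX ler_pdivrMr ?ltr0n ?expn_gt0 //.
  rewrite -natrM ler_nat.
  have E100 : 100%N = (20 * 5)%N by [].
  have E335 : 335%N = (67 * 5)%N by [].
  apply: (@leq_trans (335 ^ n)%N); first by case: n {n_ge} => // n; rewrite leq_exp2r.
  by rewrite E100 E335 !expnMn mulnA leq_mul2r NC_exp_ge ?orbT.
by split=> _; apply: bound.
Qed.
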